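(* Let $O(2)$ act on $\mathbb{R}^2$ by linear isometries (fixing the origin), with $2$ colors. Then $\mathrm{ext}_D(\mathbb{R}^2,O(2))=7$.
   Context: Let a group $\Gamma$ act faithfully on a set $X$. A coloring $c:X\to\{R,B\}$ is $\Gamma$-distinguishing if the only $\gamma\in\Gamma$ with $c\circ\gamma=c$ is the identity. For $W\subset X$ whose pointwise stabilizer in $\Gamma$ is trivial, the property $P(W)$ holds if every precoloring $c:X\setminus W\to\{R,B\}$ can be extended to a $\Gamma$-distinguishing coloring $X\to\{R,B\}$. The distinguishing extension number $\mathrm{ext}_D(X,\Gamma)$ is the smallest $m$ such that every $W\subset X$ with $|W|\geq m$ and trivial pointwise stabilizer satisfies $P(W)$ ($\infty$ if none exists). *)

(* Defs.v *)
From Stdlib Require Import Reals List.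
Import ListNotations.
Open Scope R_scope.

(* A group acting faithfully on X is represented by the set G of the maps
   X -> X by which its elements act (faithfulness = elements are determined
   by their action). The identity element is the identity map. *)

Definition distinguishing {X : Type} (G : (X -> X) -> Prop) (c : X -> bool) : Prop :=
  forall g, G g -> (forall x, c (g x) = c x) -> forall x, g x = x.

Definition trivial_pointwise_stab {X : Type} (G : (X -> X) -> Prop) (W : X -> Prop) : Prop :=
  forall g, G g -> (forall x, W x -> g x = x) -> forall x, g x = x.

(* property P(W): every precoloring of X \ W extends to a distinguishing coloring.
   A precoloring of X \ W is given by (the restriction to X \ W of) c0. *)
Definition prop_P {X : Type} (G : (X -> X) -> Prop) (W : X -> Prop) : Prop :=
  forall c0 : X -> bool,
    exists c : X -> bool, (forall x, ~ W x -> c x = c0 x) /\ distinguishing G c.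

Definition card_ge {X : Type} (W : X -> Prop) (m : nat) : Prop :=
  exists l : list X, length l = m /\ NoDup l /\ forall x, In x l -> W x.

Definition ext_bound {X : Type} (G : (X -> X) -> Prop) (m : nat) : Prop :=
  forall W : X -> Prop, card_ge W m -> trivial_pointwise_stab G W -> prop_P G W.

Definition extD_eq {X : Type} (G : (X -> X) -> Prop) (m : nat) : Prop :=
  ext_bound G m /\ forall k, ext_bound G k -> (m <= k)%nat.

Definition O2 (g : R * R -> R * R) : Prop :=
  exists a b c d : R,
    a * a + c * c = 1 /\ b * b + d * d = 1 /\ a * b + c * d = 0 /\
    forall x y : R, g (x, y) = (a * x + b * y, c * x + d * y).

(* Main.v *)
Require Import Defs.
From Stdlib Require Import Reals List Lra Lia Bool Classical.
Import ListNotations.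
Open Scope R_scope.

(* Upper bound.  A nontrivial pointwise stabilizer being excluded, W contains two
   linearly independent points.  If two such points lie on distinct circles around
   the origin, recoloring just these two suffices.  Otherwise all nonzero points of
   W, at least six, lie on one circle, and the problem lives in the group of angles.

   On the circle, suppose that all extensions are symmetric.  Flipping one point
   destroys rotational symmetry, so some extension f has only one symmetry, say
   x -> -x.  Flipping a point p off this axis gives again a coloring whose only
   symmetry is a reflection x -> u - x, hence f is invariant under translation by u
   except at p and at u - p.  Comparing the translations u, v of two points p, q:
   either q is one of p, -p, u - p, p - u, or u - p = v - q =: e with 2e = 0.  In the
   second case f is a coloring with all periods p - e, disturbed at the single
   point e, and three suitably chosen disturbed points leave no symmetry.  In the
   first case W = {0, pi, p, -p, u - p, p - u}, and this cannot be true also for the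
   axis obtained by flipping p.

   Lower bound.  Every subset of a regular pentagon has a reflection symmetry, so
   the pentagon together with the origin fails for the constant precoloring. *)

(** * Angles modulo 2 pi *)

(** Comparing points of the unit circle avoids carrying integer multiples of 2 pi. *)
Definition eqm (x y : R) : Prop := cos x = cos y /\ sin x = sin y.

Notation "x == y" := (eqm x y) (at level 70, no associativity).

Lemma eqm_refl x : x == x.
Proof. split; reflexivity. Qed.

Lemma eqm_sym x y : x == y -> y == x.
Proof. intros [H1 H2]; split; auto. Qed.

Lemma eqm_trans x y z : x == y -> y == z -> x == z.
Proof. intros [H1 H2] [H3 H4]; split; congruence. Qed.

Lemma eqm_add x y x' y' : x == y -> x' == y' -> x + x' == y + y'.
Proof.
  intros [H1 H2] [H3 H4]; split.
  - rewrite !cos_plus; congruence.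
  - rewrite !sin_plus; congruence.
Qed.

Lemma eqm_opp x y : x == y -> - x == - y.
Proof. intros [H1 H2]; split; [rewrite !cos_neg | rewrite !sin_neg]; congruence. Qed.

Lemma eqm_sub x y x' y' : x == y -> x' == y' -> x - x' == y - y'.
Proof. intros H H'; apply (eqm_add _ _ _ _ H (eqm_opp _ _ H')). Qed.

Lemma eqm_of_diff a b c d : a == b -> c - d = a - b -> c == d.
Proof.
  intros H E.
  replace c with ((a - b) + d) by lra.
  replace d with ((b - b) + d) at 2 by lra.
  apply eqm_add; [apply eqm_sub; [exact H | apply eqm_refl] | apply eqm_refl].
Qed.

Lemma eqm_2PI : 2 * PI == 0.
Proof. split; [rewrite cos_2PI, cos_0 | rewrite sin_2PI, sin_0]; reflexivity. Qed.

Lemma PI_neqm_0 : ~ PI == 0.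
Proof. intros [H _]. rewrite cos_PI, cos_0 in H. lra. Qed.

Lemma eqm_double x y : 2 * x == 2 * y -> x == y \/ x == y + PI.
Proof.
  intros H.
  assert (H0 : 2 * (x - y) == 0) by (apply (eqm_of_diff _ _ _ _ H); lra).
  destruct H0 as [H0 _]. rewrite cos_0, cos_2a_sin in H0.
  assert (S : sin (x - y) = 0) by nra.
  assert (C := sin2_cos2 (x - y)). unfold Rsqr in C. rewrite S in C.
  assert (D : (cos (x - y) - 1) * (cos (x - y) + 1) = 0) by nra.
  apply Rmult_integral in D as [D | D]; [left | right].
  - assert (Z : x - y == 0) by (split; [rewrite cos_0 | rewrite sin_0]; lra).
    apply (eqm_of_diff _ _ _ _ Z); lra.
  - assert (Z : x - y == PI) by (split; [rewrite cos_PI | rewrite sin_PI]; lra).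
    apply (eqm_of_diff _ _ _ _ Z); lra.
Qed.

Lemma eqm_dec x y : {x == y} + {~ x == y}.
Proof.
  destruct (Req_dec_T (cos x) (cos y)) as [H | H]; [| right; intros []; auto].
  destruct (Req_dec_T (sin x) (sin y)) as [H' | H']; [left | right; intros []; auto].
  split; auto.
Qed.

Declare Scope eqm_scope.
Notation "H + K" := (eqm_add _ _ _ _ H K) : eqm_scope.
Notation "H - K" := (eqm_sub _ _ _ _ H K) : eqm_scope.
Notation "- H" := (eqm_opp _ _ H) : eqm_scope.
Delimit Scope eqm_scope with eqm.

(* [lincomb e] proves a congruence [c == d] from a combination [e] of known
   congruences whose difference of sides is literally [c - d]. *)
Tactic Notation "lincomb" uconstr(e) :=
  refine (eqm_of_diff _ _ _ _ e _); lra.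

(** * Colorings of the circle, their symmetries, and the flip of one point *)

Definition circ (f : R -> bool) : Prop := forall x y, x == y -> f x = f y.
Definition rot (r : R) (f : R -> bool) : Prop := forall x, f (x + r) = f x.
Definition refl (s : R) (f : R -> bool) : Prop := forall x, f (s - x) = f x.
Definition rotfree (f : R -> bool) : Prop := forall r, rot r f -> r == 0.
Definition symmetric (f : R -> bool) : Prop :=
  (exists r, ~ r == 0 /\ rot r f) \/ (exists s, refl s f).

Definition flip (p : R) (f : R -> bool) : R -> bool :=
  fun x => if eqm_dec x p then negb (f x) else f x.

Lemma flip_at p f x : x == p -> flip p f x = negb (f x).
Proof. intros H; unfold flip; destruct (eqm_dec x p); tauto. Qed.

Lemma flip_off p f x : ~ x == p -> flip p f x = f x.
Proof. intros H; unfold flip; destruct (eqm_dec x p); tauto. Qed.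

Lemma flipK p f x : flip p (flip p f) x = f x.
Proof. unfold flip; destruct (eqm_dec x p); [apply negb_involutive | reflexivity]. Qed.

Lemma circ_flip p f : circ f -> circ (flip p f).
Proof.
  intros Hf x y H. unfold flip.
  destruct (eqm_dec x p) as [A | A], (eqm_dec y p) as [B | B];
    rewrite (Hf _ _ H); auto.
  - destruct B; exact (eqm_trans _ _ _ (eqm_sym _ _ H) A).
  - destruct A; exact (eqm_trans _ _ _ H B).
Qed.

Lemma rot_ext r f f' : (forall x, f x = f' x) -> rot r f -> rot r f'.
Proof. intros E H x. rewrite <- !E. apply H. Qed.

Lemma refl_ext s f f' : (forall x, f x = f' x) -> refl s f -> refl s f'.
Proof. intros E H x. rewrite <- !E. apply H. Qed.

Lemma rot_opp r f : rot r f -> rot (- r) f.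
Proof. intros H x. rewrite <- (H (x + - r)). f_equal; ring. Qed.

Lemma rot_add r r' f : rot r f -> rot r' f -> rot (r + r') f.
Proof. intros H H' x. rewrite <- Rplus_assoc, H'. apply H. Qed.

Lemma rot_eqm r r' f : circ f -> r == r' -> rot r f -> rot r' f.
Proof. intros Hf E H x. rewrite <- (H x). apply Hf. lincomb (- E)%eqm. Qed.

Lemma refl_eqm s s' f : circ f -> s == s' -> refl s f -> refl s' f.
Proof. intros Hf E H x. rewrite <- (H x). apply Hf. lincomb (- E)%eqm. Qed.

Lemma rot_of_refl s s' f : refl s f -> refl s' f -> rot (s - s') f.
Proof. intros H H' x. rewrite <- (H' x), <- (H (s' - x)). f_equal; ring. Qed.

(** Follow the parallelogram p, p + r, p + r', p + r + r'. The flip forces p + r' to differ from p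
    in color, while the other sides force equality. *)
Lemma flip_rot_rot f p r r' : circ f ->
  rot r f -> rot r' (flip p f) -> ~ r == 0 -> ~ r' == 0 -> False.
Proof.
  intros Hf H H' nr nr'.
  assert (E1 : f (p + r') = negb (f p)).
  { rewrite <- (flip_off p f (p + r')), H', flip_at; auto using eqm_refl.
    intros E; apply nr'; lincomb E. }
  destruct (eqm_dec (p + r + r') p) as [E | E].
  - assert (E2 : f (p + r') = f p); [| rewrite E1 in E2; destruct (f p); discriminate].
    rewrite <- (H (p + r')). apply Hf. lincomb E.
  - assert (E2 : f (p + r) = f (p + r')).
    { rewrite <- (H (p + r')), <- (flip_off p f (p + r)).
      - rewrite <- (H' (p + r)), flip_off; auto. f_equal; ring.
      - intros E2; apply nr; lincomb E2. }
    rewrite H, E1 in E2. destruct (f p); discriminate.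
Qed.

(** If the reflection moved p, then s - p would differ from p in color. But s - p + r is reflected
    to p - r, and [r] is a period of [f]. *)
Lemma flip_rot_refl f p r s : circ f ->
  rot r f -> refl s (flip p f) -> ~ r == 0 -> s == 2 * p.
Proof.
  intros Hf H H' nr. apply NNPP; intros ns.
  assert (E1 : f (s - p) = negb (f p)).
  { rewrite <- (flip_off p f (s - p)), H', flip_at; auto using eqm_refl.
    intros E; apply ns; lincomb E. }
  destruct (eqm_dec (s - p + r) p) as [E | E].
  - rewrite <- (H (s - p)), (Hf _ _ E) in E1. destruct (f p); discriminate.
  - assert (E2 : f (p - r) = f (s - p)).
    { rewrite <- (H (s - p)), <- (flip_off p f (p - r)), <- (flip_off p f (s - p + r)); auto.
      - rewrite <- (H' (p - r)). f_equal; ring.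
      - intros E2; apply nr; lincomb (- E2)%eqm. }
    assert (E3 : f (p - r) = f p) by apply (rot_opp _ _ H p).
    rewrite E3, E1 in E2. destruct (f p); discriminate.
Qed.

Lemma flip_refl_refl f p s : refl s f -> refl s (flip p f) -> s == 2 * p.
Proof.
  intros H H'. apply NNPP; intros ns.
  assert (E1 : f (s - p) = negb (f p)).
  { rewrite <- (flip_off p f (s - p)), H', flip_at; auto using eqm_refl.
    intros E; apply ns; lincomb E. }
  rewrite H in E1. destruct (f p); discriminate.
Qed.

(** * Interaction of two flips *)

(* For a coloring [f] even around [0], flipping [p] produces the axis [u / 2]
   exactly when translation by [u] changes [f] only at [p] and at [u - p]. *)
Definition jump (f : R -> bool) (p u : R) : Prop :=
  (forall x, x == p -> f (x - u) = negb (f x)) /\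
  (forall x, ~ x == p -> ~ x == u - p -> f (x - u) = f x).

Lemma jump_of_flip f p u : circ f -> refl 0 f -> refl u (flip p f) ->
  ~ u == 2 * p -> jump f p u.
Proof.
  intros Hf H0 H nu; split; intros x E.
  - rewrite <- (flip_at p f x E), <- (H x), flip_off.
    + rewrite <- (H0 (u - x)). f_equal; ring.
    + intros E'; apply nu; lincomb (E' + E)%eqm.
  - intros E'. rewrite <- (flip_off p f x E), <- (H x), flip_off.
    + rewrite <- (H0 (u - x)). f_equal; ring.
    + intros E2; apply E'. lincomb (- E2)%eqm.
Qed.

Lemma refl0 f x : refl 0 f -> f (- x) = f x.
Proof. intros H. rewrite <- (H x). f_equal; ring. Qed.

Lemma jump_opp f p u : circ f -> refl 0 f -> jump f p u -> jump f (- p) (- u).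
Proof.
  intros Hf H0 [J1 J2]; split; intros x E.
  - replace (x - - u) with (- (- x - u)) by ring.
    rewrite (refl0 _ _ H0), J1, (refl0 _ _ H0); auto. lincomb (- E)%eqm.
  - intros E'. replace (x - - u) with (- (- x - u)) by ring.
    rewrite (refl0 _ _ H0), J2, (refl0 _ _ H0); auto;
    intros E2; [apply E | apply E']; lincomb (- E2)%eqm.
Qed.

(** Compare colors on the parallelogram q, q - u, q - v, q - u - v: if only the side from q to q - v
    changes color, the parity is wrong. *)
Lemma jump_square f p u q v : circ f -> refl 0 f -> ~ u == 0 ->
  jump f p u -> jump f q v -> ~ q == p -> ~ q == u - p ->
  q - v == p \/ q - v == u - p.
Proof.
  intros Hf H0 nu [P1 P2] [Q1 Q2] n1 n2.
  apply NNPP; intros N; apply not_or_and in N as [N1 N2].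
  pose proof (Q1 q (eqm_refl q)) as E1.
  pose proof (P2 q n1 n2) as E2.
  pose proof (P2 (q - v) N1 N2) as E3.
  assert (E : f (q - v) = f (q - u)); [| rewrite E1, E2 in E; destruct (f q); discriminate].
  (* Here q - u is the second exceptional point of the jump at [q], and evenness of [f] gives the
     equality directly. *)
  destruct (eqm_dec (q - u) (v - q)) as [E4 | E4].
  - rewrite (Hf _ _ E4), <- (refl0 _ _ H0). f_equal; ring.
  - rewrite <- E3, <- (Q2 (q - u)); auto.
    + f_equal; ring.
    + intros E5; apply nu; lincomb (- E5)%eqm.
Qed.

(** [jump_square] applies to [q] and, by evenness, to - q. Adding the two congruences refutes three
    of the four combinations. *)
Lemma jump_pair f p u q v : circ f -> refl 0 f -> ~ u == 0 -> ~ 2 * p == 0 ->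
  jump f p u -> jump f q v ->
  ~ q == p -> ~ q == - p -> ~ q == u - p -> ~ q == p - u ->
  2 * (u - p) == 0 /\ v - q == u - p.
Proof.
  intros Hf H0 nu np Jp Jq n1 n2 n3 n4.
  pose proof (jump_square f p u q v Hf H0 nu Jp Jq n1 n3) as [A | A];
  pose proof (jump_square f p u (- q) (- v) Hf H0 nu Jp (jump_opp _ _ _ Hf H0 Jq)) as [B | B];
  try (intros E; first [apply n2; lincomb (- E)%eqm | apply n4; lincomb (- E)%eqm]).
  - destruct np; lincomb (- A - B)%eqm.
  - destruct nu; lincomb (- A - B)%eqm.
  - destruct nu; lincomb (- A - B)%eqm.
  - split; [lincomb (- A - B)%eqm | lincomb B].
Qed.

(** * Precolorings without asymmetric extension *)

(* The precoloring of the complement of [W] given by [f] has no asymmetric extension. *)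
Definition bad (W : R -> Prop) (f : R -> bool) : Prop :=
  forall f', circ f' -> (forall x, ~ W x -> f' x = f x) -> symmetric f'.

Definition closed (W : R -> Prop) : Prop := forall x y, x == y -> W x -> W y.

(* [W] has at least six classes modulo [2 * PI]: no five classes exhaust it. *)
Definition ge6 (W : R -> Prop) : Prop :=
  forall L : list R, (length L <= 5)%nat ->
    exists x, W x /\ forall z, In z L -> ~ x == z.

Lemma bad_flip W f p : closed W -> bad W f -> W p -> bad W (flip p f).
Proof.
  intros HW B Wp f' Hf' E. apply B; auto.
  intros x nx. rewrite E, flip_off; auto.
  intros H; apply nx; apply (HW p); auto using eqm_sym.
Qed.

Lemma bad_shift W f y : bad W f -> bad (fun x => W (x + y)) (fun x => f (x + y)).
Proof.
  intros B f' Hf' E.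
  destruct (B (fun x => f' (x - y))) as [[r [nr H]] | [s H]].
  - intros x z H; apply Hf'. lincomb H.
  - intros x nx. rewrite E.
    + f_equal; ring.
    + replace (x - y + y) with x by ring; auto.
  - left; exists r; split; auto. intros x.
    replace x with (x + y - y) at 2 by ring. rewrite <- (H (x + y)). f_equal; ring.
  - right; exists (s - 2 * y). intros x.
    replace x with (x + y - y) at 2 by ring. rewrite <- (H (x + y)). f_equal; ring.
Qed.

Lemma ge6_shift W y : ge6 W -> ge6 (fun x => W (x + y)).
Proof.
  intros H L HL. destruct (H (map (fun z => z + y) L)) as [x [Wx Hx]].
  { rewrite length_map; auto. }
  exists (x - y); split.
  - replace (x - y + y) with x by ring; auto.
  - intros z Hz E. apply (Hx (z + y)).
    + apply (in_map (fun z => z + y)); auto.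
    + lincomb E.
Qed.

Lemma closed_shift W y : closed W -> closed (fun x => W (x + y)).
Proof. intros H x z E. apply H. lincomb E. Qed.

Lemma circ_shift f y : circ f -> circ (fun x => f (x + y)).
Proof. intros H x z E. apply H. lincomb E. Qed.

Lemma rotfree_shift f y : rotfree f -> rotfree (fun x => f (x + y)).
Proof.
  intros H r Hr. apply H. intros x.
  replace x with (x - y + y) at 2 by ring. rewrite <- (Hr (x - y)). f_equal; ring.
Qed.

Lemma bad_flip_axis W f p : circ f -> closed W -> bad W f -> rotfree f -> refl 0 f ->
  W p -> ~ 2 * p == 0 ->
  exists u, ~ u == 0 /\ ~ u == 2 * p /\ rotfree (flip p f) /\
    refl u (flip p f) /\ jump f p u.
Proof.
  intros Hf HW B NR H0 Wp np.
  assert (Hf' := circ_flip p f Hf).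
  assert (NR' : rotfree (flip p f)).
  (* [f] is the flip of [flip p f], so a period of the latter would force the axis 0 of [f] through
     [p]. *)
  { intros r Hr; apply NNPP; intros nr. apply np.
    apply eqm_sym, (flip_rot_refl (flip p f) p r 0); auto.
    apply (refl_ext _ f); auto. intros x; symmetry; apply flipK. }
  destruct (bad_flip W f p HW B Wp (flip p f) Hf' (fun _ _ => eq_refl))
    as [[r [nr H]] | [u H]].
  - destruct nr; auto.
  - assert (nu2 : ~ u == 2 * p).
    (* A reflection fixing [p] would already be a symmetry of [f]; with the axis 0 it would make 2 *
       p a period. *)
    { intros E. apply np.
      enough (K : 0 - u == 0) by lincomb (- K - E)%eqm.
      apply NR. apply rot_of_refl; auto.
      apply (refl_eqm (2 * p)); auto using eqm_sym.
      pose proof (refl_eqm _ _ _ Hf' E H) as H2.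
      intros x. destruct (eqm_dec x p) as [Ex | Ex].
      - apply Hf. lincomb (- Ex - Ex)%eqm.
      - rewrite <- (flip_off p f x Ex), <- (H2 x), flip_off; auto.
        intros E'; apply Ex. lincomb (- E')%eqm. }
    exists u. split; [| split; [| split; [| split]]]; auto using jump_of_flip.
    intros E. apply np. apply eqm_sym.
    apply (flip_refl_refl f p 0); auto. apply (refl_eqm u); auto.
Qed.

(** Translation by [u] can fail only at [p] and [e]. Since p - u == e, flipping [e] repairs both
    places, and u == p - e. *)
Lemma jump_rot f p u e : circ f -> refl 0 f -> jump f p u -> u - p == e ->
  2 * e == 0 -> ~ p == e -> rot (p - e) (flip e f).
Proof.
  intros Hf H0 [J1 J2] E E2 ne.
  assert (Hf' := circ_flip e f Hf).
  apply (rot_eqm (- - u)); auto.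
  { lincomb (E + E2)%eqm. }
  apply rot_opp. intros x. change (x + - u) with (x - u).
  destruct (eqm_dec x p) as [A | A].
  - rewrite (flip_off e f x), flip_at, J1, negb_involutive; auto.
    + lincomb (A - E - E2)%eqm.
    + intros A'; apply ne. lincomb (A' - A)%eqm.
  - rewrite (flip_off e f (x - u)).
    2:{ intros K; apply A. lincomb (K + E + E2)%eqm. }
    destruct (eqm_dec x e) as [A' | A'].
    + rewrite (flip_at e f x); auto.
      rewrite (Hf x (- (p - u))) by lincomb (A' - E)%eqm.
      rewrite (Hf (x - u) (- p)) by lincomb (A' - E)%eqm.
      rewrite !(refl0 _ _ H0), J1, negb_involutive; auto using eqm_refl.
    + rewrite (flip_off e f x), J2; auto.
      intros K; apply A'. lincomb (K + E)%eqm.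
Qed.

Lemma double_eqm0 x : 2 * x == 0 -> x == 0 \/ x == PI.
Proof.
  intros H. destruct (eqm_double x 0) as [E | E].
  - lincomb H.
  - auto.
  - right; lincomb E.
Qed.

Lemma ge6_off_axis W L : ge6 W -> (length L <= 3)%nat ->
  exists x, W x /\ ~ 2 * x == 0 /\ forall z, In z L -> ~ x == z.
Proof.
  intros H HL. destruct (H (0 :: PI :: L)) as [x [Wx Hx]].
  { simpl; lia. }
  exists x; split; [| split]; auto.
  - intros E. destruct (double_eqm0 x E); [apply (Hx 0) | apply (Hx PI)]; simpl; auto.
  - intros z Hz. apply Hx; simpl; auto.
Qed.

(* Up to rotation, the only sets [W] that survive a flip [p] whose new axis
   [u / 2] does not come from a single defect of a periodic coloring. *)
Definition hexad (W : R -> Prop) (p u : R) : Prop :=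
  forall x, W x <-> x == 0 \/ x == PI \/ x == p \/ x == - p \/ x == u - p \/ x == p - u.

Lemma ge6_exhausted W a L : closed W -> ge6 W -> (length L <= 5)%nat ->
  (forall x, W x -> x == a \/ exists z, In z L /\ x == z) -> W a.
Proof.
  intros HW H6 HL H. destruct (H6 L HL) as [x [Wx Hx]].
  destruct (H x Wx) as [E | [z [Iz E]]].
  - apply (HW x); auto.
  - destruct (Hx z Iz E).
Qed.

Lemma hexad_of_subset W p u : closed W -> ge6 W ->
  (forall x, W x -> x == 0 \/ x == PI \/ x == p \/ x == - p \/ x == u - p \/ x == p - u) ->
  hexad W p u.
Proof.
  intros HW H6 H x; split; auto.
  intros E; destruct E as [E | [E | [E | [E | [E | E]]]]];
    apply (HW _ _ (eqm_sym _ _ E));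
    [ apply (ge6_exhausted W 0 [PI; p; - p; u - p; p - u])
    | apply (ge6_exhausted W PI [0; p; - p; u - p; p - u])
    | apply (ge6_exhausted W p [0; PI; - p; u - p; p - u])
    | apply (ge6_exhausted W (- p) [0; PI; p; u - p; p - u])
    | apply (ge6_exhausted W (u - p) [0; PI; p; - p; p - u])
    | apply (ge6_exhausted W (p - u) [0; PI; p; - p; u - p]) ]; auto;
    intros z Wz; simpl;
    destruct (H z Wz) as [D | [D | [D | [D | [D | D]]]]];
    solve [left; exact D | right; eexists; split; [| exact D]; tauto].
Qed.

(** Flip one point [p] and take the new axis [u]. If u - p is 0 or pi, it serves as [e] for all
    points by [jump_pair]; if not, [jump_pair] confines the other points off the axis to - p, u - p
    and p - u. *)
Lemma axis_dichotomy W f : circ f -> closed W -> ge6 W -> bad W f -> rotfree f ->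
  refl 0 f ->
  (exists e, 2 * e == 0 /\ forall p, W p -> ~ 2 * p == 0 -> rot (p - e) (flip e f)) \/
  (exists p u, ~ 2 * p == 0 /\ ~ u == 0 /\ ~ u == 2 * p /\
     rotfree (flip p f) /\ refl u (flip p f) /\ hexad W p u).
Proof.
  intros Hf HW H6 B NR H0.
  destruct (ge6_off_axis W [] H6) as [p [Wp [np _]]]; [simpl; lia |].
  destruct (bad_flip_axis W f p) as [u [nu [nu2 [NR' [Hu Jp]]]]]; auto.
  assert (off : forall q e, ~ 2 * q == 0 -> 2 * e == 0 -> ~ q == e).
  { intros q e nq E K; apply nq. lincomb (K + K + E)%eqm. }
  destruct (eqm_dec (2 * (u - p)) 0) as [E | E].
  - left; exists (u - p); split; auto.
    assert (Rp : rot (p - (u - p)) (flip (u - p) f)).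
    { apply (jump_rot f p u); auto using eqm_refl. }
    assert (Hf' := circ_flip (u - p) f Hf).
    intros q Wq nq.
    destruct (eqm_dec q p) as [E1 | E1].
    { apply (rot_eqm (p - (u - p))); auto. lincomb (- E1)%eqm. }
    destruct (eqm_dec q (- p)) as [E2 | E2].
    { apply (rot_eqm (- (p - (u - p)))); auto using rot_opp. lincomb (E - E2)%eqm. }
    destruct (bad_flip_axis W f q) as [v [nv [nv2 [_ [Hv Jq]]]]]; auto.
    destruct (jump_pair f p u q v) as [_ V]; auto.
    { apply off; auto. lincomb (- E)%eqm. }
    apply (jump_rot f q v); auto.
  - right; exists p, u. do 5 (split; auto).
    apply hexad_of_subset; auto.
    intros q Wq.
    destruct (eqm_dec (2 * q) 0) as [E1 | E1].
    { destruct (double_eqm0 q E1); auto. }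
    destruct (bad_flip_axis W f q) as [v [nv [nv2 [_ [Hv Jq]]]]]; auto.
    apply NNPP; intros N. destruct (jump_pair f p u q v) as [V _]; auto 10; tauto.
Qed.

(** * Periodic colorings with marked points *)

(** [E] marks points of [g], and x -> r + e * x covers both kinds of symmetry. If [r] is a period of
    [g], the map preserves [g] and hence the marks. If not, [g] is constant on its periods and on
    their images, so either all periods keep their mark status or all swap it. *)
Lemma marked_symmetric g E : circ g -> circ E -> refl 0 g ->
  symmetric (fun x => xorb (g x) (E x)) ->
  exists r e, (e = 1 /\ ~ r == 0 \/ e = -1) /\
    (rot r g /\ (forall x, E (r + e * x) = E x) \/
     ~ rot r g /\ (forall x, rot x g -> xorb (E (r + e * x)) (E x) = xorb (E r) (E 0))).
Proof.
  intros Hg HE H0 S.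
  assert (T : exists r e, (e = 1 /\ ~ r == 0 \/ e = -1) /\
    forall x, xorb (g (r + e * x)) (E (r + e * x)) = xorb (g x) (E x)).
  { destruct S as [[r [nr S]] | [s S]].
    - exists r, 1; split; auto. intros x. rewrite <- (S x).
      replace (r + 1 * x) with (x + r) by ring; auto.
    - exists s, (-1); split; auto. intros x. rewrite <- (S x).
      replace (s + -1 * x) with (s - x) by ring; auto. }
  destruct T as [r [e [He T]]]. exists r, e; split; auto.
  destruct (classic (rot r g)) as [P | P]; [left | right]; split; auto.
  - intros x. specialize (T x).
    assert (Z : g (r + e * x) = g x).
    { destruct He as [[-> _] | ->].
      - rewrite <- (P x). f_equal; ring.
      - rewrite <- (refl0 _ x H0), <- (P (- x)). f_equal; ring. }
    rewrite Z in T. destruct (g x), (E (r + e * x)), (E x); simpl in *; congruence.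
  - intros x Px.
    assert (Z : g (r + e * x) = g r).
    { destruct He as [[-> _] | ->].
      - rewrite <- (Px r). f_equal; ring.
      - rewrite <- (rot_opp _ _ Px r). f_equal; ring. }
    assert (Z0 : g x = g 0) by (rewrite <- (Px 0); f_equal; ring).
    pose proof (T x) as T1. pose proof (T 0) as T0.
    replace (r + e * 0) with r in T0 by ring.
    rewrite Z, Z0 in T1.
    destruct (g r), (g 0), (E (r + e * x)), (E x), (E r), (E 0); simpl in *; congruence.
Qed.

Definition mark3 (a b c x : R) : bool :=
  if eqm_dec x a then true else if eqm_dec x b then true else
  if eqm_dec x c then true else false.

Lemma mark3P a b c x : mark3 a b c x = true <-> x == a \/ x == b \/ x == c.
Proof.
  unfold mark3. destruct (eqm_dec x a), (eqm_dec x b), (eqm_dec x c);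
    split; intros; try discriminate; auto; tauto.
Qed.

Lemma circ_mark3 a b c : circ (mark3 a b c).
Proof.
  intros x y E. apply eq_true_iff_eq. rewrite !mark3P.
  split; intros [H | [H | H]];
    [left | right; left | right; right | left | right; left | right; right];
    solve [exact (eqm_trans _ _ _ E H) | exact (eqm_trans _ _ _ (eqm_sym _ _ E) H)].
Qed.

Lemma bad_mark3 W g p q : closed W -> circ g -> bad W (flip 0 g) -> W p -> W q ->
  ~ p == 0 -> ~ q == 0 -> symmetric (fun x => xorb (g x) (mark3 0 p q x)).
Proof.
  intros HW Hg B Wp Wq np nq. apply B.
  - intros x y E. rewrite (Hg x y E), (circ_mark3 0 p q x y E); auto.
  - intros x nx. unfold mark3, flip.
    destruct (eqm_dec x 0) as [E | E]; [apply xorb_true_r |].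
    destruct (eqm_dec x p) as [E1 | E1]; [destruct nx; apply (HW p); auto using eqm_sym |].
    destruct (eqm_dec x q) as [E2 | E2]; [destruct nx; apply (HW q); auto using eqm_sym |].
    apply xorb_false_r.
Qed.

(** Mark 0, [p] and [q]. A symmetry permuting the marks makes the triangle isosceles; the
    alternatives are the apex at 0, at [p] and at [q]. *)
Lemma isosceles W g p q : closed W -> ge6 W -> circ g -> refl 0 g -> bad W (flip 0 g) ->
  (forall x, W x -> ~ 2 * x == 0 -> rot x g) ->
  W p -> ~ 2 * p == 0 -> W q -> ~ 2 * q == 0 -> ~ q == p ->
  q == - p \/ q == 2 * p \/ p == 2 * q.
Proof.
  intros HW H6 Hg H0 B P Wp np Wq nq npq.
  apply NNPP; intros N; apply not_or_and in N as [N1 N]; apply not_or_and in N as [N2 N3].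
  assert (np0 : ~ p == 0) by (intros E; apply np; lincomb (E + E)%eqm).
  assert (nq0 : ~ q == 0) by (intros E; apply nq; lincomb (E + E)%eqm).
  assert (S := bad_mark3 W g p q HW Hg B Wp Wq np0 nq0).
  apply marked_symmetric in S as [r [e [He [[Pr S] | [Pr S]]]]]; auto using circ_mark3.
  - assert (M : forall x, x == 0 \/ x == p \/ x == q ->
      r + e * x == 0 \/ r + e * x == p \/ r + e * x == q).
    { intros x Hx. apply mark3P. rewrite S. apply mark3P; auto. }
    pose proof (M 0 (or_introl (eqm_refl 0))) as M0.
    pose proof (M p (or_intror (or_introl (eqm_refl p)))) as Mp.
    pose proof (M q (or_intror (or_intror (eqm_refl q)))) as Mq.
    destruct He as [[-> nr] | ->].
    + destruct M0 as [M0 | [M0 | M0]].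
      * apply nr; lincomb M0.
      * destruct Mp as [K | [K | K]].
        -- apply np; lincomb (K - M0)%eqm.
        -- apply nr; lincomb K.
        -- apply N2; lincomb (M0 - K)%eqm.
      * destruct Mq as [K | [K | K]].
        -- apply nq; lincomb (K - M0)%eqm.
        -- apply N3; lincomb (M0 - K)%eqm.
        -- apply nr; lincomb K.
    + destruct M0 as [M0 | [M0 | M0]].
      * destruct Mp as [K | [K | K]].
        -- apply np0; lincomb (M0 - K)%eqm.
        -- apply np; lincomb (M0 - K)%eqm.
        -- apply N1; lincomb (M0 - K)%eqm.
      * destruct Mq as [K | [K | K]].
        -- apply npq; lincomb (M0 - K)%eqm.
        -- apply nq0; lincomb (M0 - K)%eqm.
        -- apply N3; lincomb (K - M0)%eqm.
      * destruct Mp as [K | [K | K]].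
        -- apply npq; lincomb (K - M0)%eqm.
        -- apply N2; lincomb (K - M0)%eqm.
        -- apply np0; lincomb (M0 - K)%eqm.
  (* All marks are periods but no image of a period is one, so no image is marked. Then all periods
     have the same mark status, although 0 is marked and [z] is not. *)
  - destruct (ge6_off_axis W [0; p; q] H6) as [z [Wz [nz Hz]]]; [simpl; lia |].
    assert (Off : forall x, rot x g -> mark3 0 p q (r + e * x) = false).
    { intros x Px. destruct (mark3 0 p q (r + e * x)) eqn:M; auto.
      apply mark3P in M. destruct Pr.
      assert (Pe : rot (- (e * x)) g).
      { destruct He as [[-> _] | ->].
        - apply rot_opp. replace (1 * x) with x by ring; auto.
        - replace (- (-1 * x)) with x by ring; auto. }
      destruct M as [M | [M | M]].
      - apply (rot_eqm (- (e * x))); auto. lincomb (- M)%eqm.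
      - apply (rot_eqm (p + - (e * x))); auto using rot_add. lincomb (- M)%eqm.
      - apply (rot_eqm (q + - (e * x))); auto using rot_add. lincomb (- M)%eqm. }
    assert (P0 : rot 0 g) by (intros x; f_equal; ring).
    pose proof (S z (P z Wz nz)) as Sz.
    assert (Or := Off 0 P0). replace (r + e * 0) with r in Or by ring.
    rewrite Or, Off in Sz; auto.
    rewrite (proj2 (mark3P 0 p q 0)) in Sz by auto using eqm_refl.
    simpl in Sz. apply mark3P in Sz. simpl in Hz.
    destruct Sz as [K | [K | K]]; revert K; apply Hz; auto.
Qed.

(* The one configuration not excluded by [isosceles]: all triangles of a
   regular pentagon are isosceles, so an antipode has to break the symmetry. *)
Lemma pentagon_asymmetric W g a : closed W -> circ g -> refl 0 g -> bad W (flip 0 g) ->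
  W a -> ~ 2 * a == 0 -> rot a g -> 5 * a == 0 -> W PI -> False.
Proof.
  intros HW Hg H0 B Wa na Pa a5 WPI.
  assert (na0 : ~ a == 0) by (intros E; apply na; lincomb (E + E)%eqm).
  assert (h := eqm_2PI). assert (nh := PI_neqm_0).
  assert (nah : ~ a == PI) by (intros E; apply na; lincomb (E + E + h)%eqm).
  assert (na2h : ~ 2 * a == PI) by (intros E; apply na0; lincomb (a5 - E - E - h)%eqm).
  assert (S := bad_mark3 W g PI a HW Hg B WPI Wa nh na0).
  apply marked_symmetric in S as [r [e [He [[Pr S] | [Pr S]]]]]; auto using circ_mark3.
  (* The triangle 0, pi, [a] is scalene. *)
  - assert (M : forall x, x == 0 \/ x == PI \/ x == a ->
      r + e * x == 0 \/ r + e * x == PI \/ r + e * x == a).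
    { intros x Hx. apply mark3P. rewrite S. apply mark3P; auto. }
    pose proof (M 0 (or_introl (eqm_refl 0))) as M0.
    pose proof (M PI (or_intror (or_introl (eqm_refl PI)))) as Mh.
    pose proof (M a (or_intror (or_intror (eqm_refl a)))) as Ma.
    destruct He as [[-> nr] | ->].
    + destruct M0 as [M0 | [M0 | M0]].
      * apply nr; lincomb M0.
      * destruct Ma as [K | [K | K]].
        -- apply nah; lincomb (K - M0 - h)%eqm.
        -- apply na0; lincomb (K - M0)%eqm.
        -- apply nr; lincomb K.
      * destruct Ma as [K | [K | K]].
        -- apply na; lincomb (K - M0)%eqm.
        -- apply na2h; lincomb (K - M0)%eqm.
        -- apply nr; lincomb K.
    + destruct M0 as [M0 | [M0 | M0]].
      * destruct Ma as [K | [K | K]].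
        -- apply na0; lincomb (M0 - K)%eqm.
        -- apply nah; lincomb (M0 - K - h)%eqm.
        -- apply na; lincomb (M0 - K)%eqm.
      * destruct Ma as [K | [K | K]].
        -- apply nah; lincomb (M0 - K)%eqm.
        -- apply na0; lincomb (M0 - K)%eqm.
        -- apply na2h; lincomb (M0 - K)%eqm.
      * destruct Mh as [K | [K | K]].
        -- apply nah; lincomb (K - M0)%eqm.
        -- apply na0; lincomb (K - M0 + h)%eqm.
        -- apply nh; lincomb (M0 - K)%eqm.
  (* The periods 0 and a are marked, 2a and 3a are not, so either the images of the first two or
     those of the last two are both marked. But a marked image must be pi, since 0 and a are
     periods. *)
  - assert (P0 : rot 0 g) by (intros x; f_equal; ring).
    assert (P2 := rot_add _ _ _ Pa Pa). assert (P3 := rot_add _ _ _ Pa P2).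
    assert (Off : forall x, rot x g -> mark3 0 PI a (r + e * x) = true -> r + e * x == PI).
    { intros x Px M. apply mark3P in M.
      assert (Pe : rot (- (e * x)) g).
      { destruct He as [[-> _] | ->].
        - apply rot_opp. replace (1 * x) with x by ring; auto.
        - replace (- (-1 * x)) with x by ring; auto. }
      destruct M as [M | [M | M]]; auto; destruct Pr.
      - apply (rot_eqm (- (e * x))); auto. lincomb (- M)%eqm.
      - apply (rot_eqm (a + - (e * x))); auto using rot_add. lincomb (- M)%eqm. }
    assert (One : forall x y, rot x g -> rot y g -> ~ y == x ->
      mark3 0 PI a (r + e * x) = true -> mark3 0 PI a (r + e * y) = true -> False).
    { intros x y Px Py n Mx My. apply n.
      assert (Mx' := Off x Px Mx). assert (My' := Off y Py My).
      destruct He as [[-> _] | ->]; [lincomb (My' - Mx')%eqm | lincomb (Mx' - My')%eqm]. }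
    pose proof (S 0 P0) as S0. pose proof (S a Pa) as Sa.
    pose proof (S _ P2) as S2. pose proof (S _ P3) as S3.
    assert (O1 := One 0 a P0 Pa na0).
    assert (O2 := One (a + a) (a + (a + a)) P2 P3).
    rewrite (proj2 (mark3P 0 PI a 0)) in * by auto using eqm_refl.
    rewrite (proj2 (mark3P 0 PI a a)) in * by auto using eqm_refl.
    assert (M2 : mark3 0 PI a (a + a) = false).
    { apply not_true_is_false. rewrite mark3P. intros [K | [K | K]].
      - apply na; lincomb K.
      - apply na2h; lincomb K.
      - apply na0; lincomb K. }
    assert (M3 : mark3 0 PI a (a + (a + a)) = false).
    { apply not_true_is_false. rewrite mark3P. intros [K | [K | K]].
      - apply na; lincomb (a5 - K)%eqm.
      - apply na0; lincomb (K + K + h - a5)%eqm.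
      - apply na; lincomb K. }
    rewrite M2 in S2. rewrite M3 in S3.
    replace (r + e * 0) with r in * by ring.
    destruct (mark3 0 PI a r), (mark3 0 PI a (r + e * a)),
      (mark3 0 PI a (r + e * (a + a))), (mark3 0 PI a (r + e * (a + (a + a))));
      simpl in *; try discriminate; auto.
    apply O2; auto. intros K; apply na0; lincomb K.
Qed.

(** At least four points of [W] lie off the axis, and any two satisfy [isosceles]. This closes them
    under negation and doubling and leaves a, - a, 2a, - 2a with 5a = 0. *)
Lemma periodic_not_bad W g : closed W -> ge6 W -> circ g -> refl 0 g ->
  bad W (flip 0 g) -> (forall x, W x -> ~ 2 * x == 0 -> rot x g) -> False.
Proof.
  intros HW H6 Hg H0 B P.
  set (V x := W x /\ ~ 2 * x == 0).
  assert (HV : closed V).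
  { intros x y E [Wx nx]; split; [apply (HW x); auto |].
    intros K; apply nx; lincomb (E + E + K)%eqm. }
  assert (V4 : forall L, (length L <= 3)%nat ->
    exists x, V x /\ forall z, In z L -> ~ x == z).
  { intros L HL. destruct (ge6_off_axis W L H6 HL) as [x [Wx [nx Hx]]].
    exists x; repeat split; auto. }
  assert (Iso : forall p q, V p -> V q -> ~ q == p -> q == - p \/ q == 2 * p \/ p == 2 * q).
  { intros p q [Wp np] [Wq nq]. apply (isosceles W g); auto. }
  assert (h := eqm_2PI).
  (* Two distinct halves of [a] differ by pi, which contradicts each case of [Iso]. *)
  assert (Half : forall a b c, V a -> V b -> V c -> a == 2 * b -> a == 2 * c -> ~ c == b -> False).
  { intros a b c Va Vb Vc E1 E2 n.
    assert (na : ~ 2 * a == 0) by apply Va.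
    destruct (eqm_double b c) as [K | K]; [lincomb (E2 - E1)%eqm | apply n; lincomb (- K)%eqm |].
    destruct (Iso b c Vb Vc n) as [K' | [K' | K']].
    - apply na. lincomb (E1 + E1 + K + K + K' + K' + h)%eqm.
    - apply (proj2 Vc). lincomb (- K' - (E2 - E1) - K' - (E2 - E1))%eqm.
    - apply (proj2 Vb). lincomb (- K' - (E1 - E2) - K' - (E1 - E2))%eqm. }
  (* Besides [a] and [b], two more points of [V] exist and would both be halves of [a]. *)
  assert (Step : forall a b, V a -> (forall q, V q -> ~ q == a -> ~ q == b -> a == 2 * q) -> False).
  { intros a b Va H.
    destruct (V4 [a; b]) as [x [Vx Hx]]; [simpl; lia |].
    destruct (V4 [a; b; x]) as [y [Vy Hy]]; [simpl; lia |].
    simpl in Hx, Hy. apply (Half a x y); auto 6. }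
  assert (Neg : forall a, V a -> V (- a)).
  { intros a Va. apply NNPP; intros N. apply (Step a (2 * a) Va).
    intros q Vq n1 n2. destruct (Iso a q Va Vq n1) as [K | [K | K]]; auto; [| tauto].
    destruct N; apply (HV q); auto. }
  assert (Dbl : forall a, V a -> V (2 * a)).
  { intros a Va. apply NNPP; intros N. apply (Step a (- a) Va).
    intros q Vq n1 n2. destruct (Iso a q Va Vq n1) as [K | [K | K]]; auto; [tauto |].
    destruct N; apply (HV q); auto. }
  destruct (V4 []) as [a [Va _]]; [simpl; lia |].
  assert (a3 : ~ 3 * a == 0).
  { intros E. apply (Step a (- a) Va).
    intros q Vq n1 n2. destruct (Iso a q Va Vq n1) as [K | [K | K]]; auto; [tauto |].
    destruct n2; lincomb (K + E)%eqm. }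
  assert (Vm := Neg _ (Dbl _ Va)).
  assert (na : ~ 2 * a == 0) by apply Va.
  assert (a5 : 5 * a == 0).
  { destruct (Iso a (- (2 * a)) Va Vm) as [K | [K | K]].
    - intros K; apply a3; lincomb (- K)%eqm.
    - destruct na; lincomb (- K - K)%eqm.
    - destruct (proj2 (Dbl _ Va)); lincomb (- K)%eqm.
    - lincomb K. }
  apply (pentagon_asymmetric W g a); auto; try apply Va.
  { apply P; apply Va. }
  (* The other five classes cannot exhaust [W], so pi belongs to it. *)
  apply (ge6_exhausted W PI [0; a; - a; 2 * a; - (2 * a)]); auto.
  intros x Wx. simpl.
  destruct (eqm_dec (2 * x) 0) as [E | E].
  { destruct (double_eqm0 x E); eauto. }
  right. apply NNPP; intros N.
  assert (N' : forall z, In z [0; a; - a; 2 * a; - (2 * a)] -> ~ x == z).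
  { intros z Iz K; apply N; exists z; auto. }
  simpl in N'. assert (Vx : V x) by (split; auto).
  destruct (Iso a x Va Vx) as [K | [K | K]].
  - auto.
  - revert K; apply N'; auto.
  - revert K; apply N'; auto.
  (* As 5a = 0, the point - 2a is already a half of [a]. *)
  - apply (Half a (- (2 * a)) x); auto; [lincomb a5 | auto 7].
Qed.

(** Shift the defect [e] to 0 and undo it: [g] is the periodic coloring and [flip 0 g] the shifted
    [f]. The axis 0 survives because 2e = 0. *)
Lemma no_common_period W f : circ f -> closed W -> ge6 W -> bad W f -> refl 0 f ->
  ~ exists e, 2 * e == 0 /\ forall p, W p -> ~ 2 * p == 0 -> rot (p - e) (flip e f).
Proof.
  intros Hf HW H6 B H0 [e [E He]].
  set (g x := flip e f (x + e)).
  apply (periodic_not_bad (fun x => W (x + e)) g).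
  - apply closed_shift; auto.
  - apply ge6_shift; auto.
  - apply (circ_shift (flip e f)), circ_flip; auto.
  - intros x. unfold g, flip.
    rewrite (Hf (0 - x + e) (- (x + e))) by lincomb E.
    rewrite (refl0 _ _ H0).
    destruct (eqm_dec (0 - x + e) e) as [A | A], (eqm_dec (x + e) e) as [C | C]; auto.
    + destruct C; lincomb (- A)%eqm.
    + destruct A; lincomb (- C)%eqm.
  - intros f' Hf' K. apply (bad_shift W f e B f' Hf').
    intros x nx. rewrite K by auto. unfold g, flip.
    destruct (eqm_dec x 0) as [A | A], (eqm_dec (x + e) e) as [C | C];
      auto using negb_involutive.
    + destruct C; lincomb A.
    + destruct A; lincomb C.
  - intros x Wx nx y. unfold g.
    assert (nx' : ~ 2 * (x + e) == 0) by (intros K; apply nx; lincomb (K - E)%eqm).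
    rewrite <- (He (x + e) Wx nx' (y + e)). f_equal; ring.
Qed.

(** * Six points on one circle suffice *)

Theorem circle_extension W f : circ f -> closed W -> ge6 W -> ~ bad W f.
Proof.
  intros Hf HW H6 B.
  assert (S : exists f s, circ f /\ bad W f /\ rotfree f /\ refl s f).
  { assert (S : exists f, circ f /\ bad W f /\ rotfree f).
    { destruct (classic (rotfree f)) as [N | N]; [exists f; auto |].
      destruct (H6 []) as [p [Wp _]]; [simpl; lia |].
      exists (flip p f). split; [| split]; auto using circ_flip, bad_flip.
      intros r Hr. apply NNPP; intros nr. apply N.
      intros r' Hr'. apply NNPP; intros nr'. apply (flip_rot_rot f p r' r); auto. }
    destruct S as [f1 [C1 [B1 N1]]].
    destruct (B1 f1 C1 (fun _ _ => eq_refl)) as [[r [nr Hr]] | [s Hs]].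
    - destruct nr; auto.
    - exists f1, s; auto. }
  (* With the axis s / 2 moved to 0 and the periodic case excluded, [W] is a hexad around each axis
     that arises. *)
  assert (C : forall W f s, closed W -> ge6 W -> circ f -> bad W f -> rotfree f -> refl s f ->
     exists p u, ~ 2 * p == 0 /\ ~ u == 0 /\ ~ u == 2 * p /\
     rotfree (flip (p + s / 2) f) /\ refl (u + s) (flip (p + s / 2) f) /\
     hexad (fun x => W (x + s / 2)) p u).
  { clear. intros W f s HW H6 Hf B NR Hs.
    set (W' x := W (x + s / 2)). set (f' x := f (x + s / 2)).
    assert (HW' : closed W') by (apply closed_shift; auto).
    assert (H6' : ge6 W') by (apply ge6_shift; auto).
    assert (Hf' : circ f') by (apply circ_shift; auto).
    assert (B' : bad W' f') by (apply bad_shift; auto).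
    assert (NR' : rotfree f') by (apply rotfree_shift; auto).
    assert (H0 : refl 0 f').
    { intros x. unfold f'. rewrite <- (Hs (x + s / 2)). f_equal; field. }
    destruct (axis_dichotomy W' f') as [K | [p [u [np [nu [nu2 [NRp [Hu Hex]]]]]]]]; auto.
    { destruct (no_common_period W' f'); auto. }
    exists p, u. do 3 (split; auto).
    assert (X : forall x, flip p f' x = flip (p + s / 2) f (x + s / 2)).
    { intros x. unfold flip, f'.
      destruct (eqm_dec x p) as [A | A], (eqm_dec (x + s / 2) (p + s / 2)) as [C | C]; auto.
      - destruct C; lincomb A.
      - destruct A; lincomb C. }
    split; [| split]; auto.
    - intros r Hr. apply NRp. intros x. rewrite !X, <- (Hr (x + s / 2)). f_equal; ring.
    - intros x. pose proof (Hu (x - s / 2)) as K. rewrite !X in K.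
      replace (x - s / 2 + s / 2) with x in K by ring.
      rewrite <- K. f_equal. field. }
  clear f Hf B. destruct S as [f [s [Hf [B [NR Hs]]]]].
  destruct (C W f s HW H6 Hf B NR Hs) as [p [u [np [nu [nu2 [NR1 [Hu Hex]]]]]]].
  assert (Wp : W (p + s / 2)) by (apply Hex; auto using eqm_refl).
  destruct (C W (flip (p + s / 2) f) (u + s) HW H6) as [q [v [_ [_ [_ [_ [_ Hex']]]]]]];
    auto using circ_flip, bad_flip.
  assert (h := eqm_2PI).
  (* Both axes are symmetry axes of [W] and meet [W] in an antipodal pair. *)
  assert (Y : forall y, 2 * y == u -> W (y + s / 2) -> y == - p \/ y == p - u).
  { intros y Ey Wy. apply Hex in Wy as [K | [K | [K | [K | [K | K]]]]]; auto.
    - destruct nu; lincomb (K + K - Ey)%eqm.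
    - destruct nu; lincomb (K + K + h - Ey)%eqm.
    - destruct nu2; lincomb (K + K - Ey)%eqm.
    - destruct nu2; lincomb (Ey - K - K)%eqm. }
  assert (E1 : u / 2 == - p \/ u / 2 == p - u).
  { apply Y; [replace (2 * (u / 2)) with u by field; apply eqm_refl |].
    replace (u / 2 + s / 2) with (0 + (u + s) / 2) by field.
    apply Hex'; auto using eqm_refl. }
  assert (E2 : PI + u / 2 == - p \/ PI + u / 2 == p - u).
  { apply Y; [lincomb h |].
    replace (PI + u / 2 + s / 2) with (PI + (u + s) / 2) by field.
    apply Hex'; auto using eqm_refl. }
  assert (nh := PI_neqm_0).
  (* The antipodal pair on the new axis consists of - p and p - u, in either order. *)
  assert (E : u == - (2 * p) /\ 4 * p == PI).
  { destruct E1 as [E1 | E1], E2 as [E2 | E2].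
    - destruct nh; lincomb (E2 - E1)%eqm.
    - assert (Eu : u == - (2 * p)) by lincomb (E1 + E1)%eqm.
      split; auto. lincomb (E1 - E2 + Eu)%eqm.
    - assert (Eu : u == - (2 * p)) by lincomb (E2 + E2 - h)%eqm.
      split; auto. lincomb (E2 - E1 + Eu - h)%eqm.
    - destruct nh; lincomb (E2 - E1)%eqm. }
  destruct E as [Eu E4].
  (* The new axis reflects 0 to u = - 2p, so this point lies in [W]. But with 4p = pi the first
     hexad is a regular octagon without 2p and - 2p. *)
  assert (W0 : W (u + s / 2)).
  { replace (u + s / 2) with (u / 2 + (u + s) / 2) by field. apply Hex'.
    assert (W0 : W (- (u / 2) + (u + s) / 2)).
    { replace (- (u / 2) + (u + s) / 2) with (0 + s / 2) by field.
      apply Hex; auto using eqm_refl. }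
    apply Hex' in W0 as [K | [K | [K | [K | [K | K]]]]].
    - left; lincomb (- K)%eqm.
    - right; left; lincomb (- K - h)%eqm.
    - do 3 right; left; lincomb (- K)%eqm.
    - do 2 right; left; lincomb (- K)%eqm.
    - do 5 right; lincomb (- K)%eqm.
    - do 4 right; left; lincomb (- K)%eqm. }
  apply Hex in W0 as [K | [K | [K | [K | [K | K]]]]].
  - auto.
  - apply np. lincomb (E4 + h + K - Eu)%eqm.
  - apply np. lincomb (E4 + E4 + h + (K - Eu) + (K - Eu))%eqm.
  - apply np. lincomb (Eu - K + Eu - K)%eqm.
  - apply np. lincomb (K + K)%eqm.
  - apply np. lincomb (- (K - Eu - Eu) - (K - Eu - Eu) - (E4 + E4 + h))%eqm.
Qed.

(** * Two points on distinct circles *)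

Definition fl (a : bool) (p : R) (f : R -> bool) : R -> bool := if a then flip p f else f.

Lemma fl_negb a p f x : fl (negb a) p f x = flip p (fl a p f) x.
Proof. destruct a; simpl; auto. symmetry; apply flipK. Qed.

Lemma circ_fl a p f : circ f -> circ (fl a p f).
Proof. destruct a; auto using circ_flip. Qed.

Lemma fl_rot_rot a p f r r' : circ f ->
  rot r (fl a p f) -> rot r' (fl (negb a) p f) -> ~ r == 0 -> ~ r' == 0 -> False.
Proof.
  intros Hf H H'. apply (flip_rot_rot (fl a p f) p); auto using circ_fl.
  apply (rot_ext _ _ _ (fl_negb a p f)); auto.
Qed.

Lemma fl_rot_refl a p f r s : circ f ->
  rot r (fl a p f) -> refl s (fl (negb a) p f) -> ~ r == 0 -> s == 2 * p.
Proof.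
  intros Hf H H'. apply (flip_rot_refl (fl a p f) p); auto using circ_fl.
  apply (refl_ext _ _ _ (fl_negb a p f)); auto.
Qed.

Lemma fl_refl_refl a p f s :
  refl s (fl a p f) -> refl s (fl (negb a) p f) -> s == 2 * p.
Proof.
  intros H H'. apply (flip_refl_refl (fl a p f) p); auto.
  apply (refl_ext _ _ _ (fl_negb a p f)); auto.
Qed.

Definition common (f1 f2 : R -> bool) : Prop :=
  (exists r, ~ r == 0 /\ rot r f1 /\ rot r f2) \/ (exists s, refl s f1 /\ refl s f2).

(** No reflection fixes both angles [a] and [b], but common symmetries for all four choices of flips
    would produce one. *)
Lemma two_circles f1 f2 a b : circ f1 -> circ f2 -> ~ 2 * a == 2 * b ->
  exists i j, ~ common (fl i a f1) (fl j b f2).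
Proof.
  intros H1 H2 nab. apply NNPP; intros N.
  assert (C : forall i j, common (fl i a f1) (fl j b f2)).
  { intros i j; apply NNPP; intros K; apply N; exists i, j; auto. }
  assert (C' : forall i j, exists s, refl s (fl i a f1) /\ refl s (fl j b f2)).
  (* A common rotation for one choice excludes a rotation for the opposite choice and forces its
     reflection through both points. *)
  { intros i j. destruct (C i j) as [[r [nr [R1 R2]]] | K]; auto. exfalso.
    destruct (C (negb i) (negb j)) as [[r' [nr' [R1' R2']]] | [s [S1 S2]]].
    - apply (fl_rot_rot i a f1 r r'); auto.
    - apply nab. assert (E1 := fl_rot_refl _ _ _ _ _ H1 R1 S1 nr).
      assert (E2 := fl_rot_refl _ _ _ _ _ H2 R2 S2 nr). lincomb (E2 - E1)%eqm. }
  destruct (C' false false) as [s00 [A00 B00]].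
  destruct (C' false true) as [s01 [A01 B01]].
  destruct (C' true false) as [s10 [A10 B10]].
  destruct (C' true true) as [s11 [A11 B11]].
  (* An axis surviving a flip passes through the flipped point. Two different axes of one coloring
     compose to a rotation, which forces every axis after the flip through that point. *)
  destruct (eqm_dec s00 s01) as [E | E].
  - assert (E0 : s00 == 2 * b).
    { apply (fl_refl_refl false b f2); auto.
      apply (refl_eqm s01); auto using circ_fl, eqm_sym. }
    destruct (eqm_dec s00 s10) as [E' | E'].
    + apply nab. assert (E1 : s00 == 2 * a); [| lincomb (E0 - E1)%eqm].
      apply (fl_refl_refl false a f1); auto.
      apply (refl_eqm s10); auto using circ_fl, eqm_sym.
    + assert (R := rot_of_refl _ _ _ B00 B10).
      assert (nr : ~ s00 - s10 == 0) by (intros K; apply E'; lincomb K).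
      assert (E1 := fl_rot_refl false b f2 _ _ H2 R B01 nr).
      assert (E2 := fl_rot_refl false b f2 _ _ H2 R B11 nr).
      apply nab. assert (E3 : s01 == 2 * a); [| lincomb (E1 - E3)%eqm].
      apply (fl_refl_refl false a f1); auto.
      apply (refl_eqm s11); auto using circ_fl. lincomb (E2 - E1)%eqm.
  - assert (R := rot_of_refl _ _ _ A00 A01).
    assert (nr : ~ s00 - s01 == 0) by (intros K; apply E; lincomb K).
    assert (E1 := fl_rot_refl false a f1 _ _ H1 R A10 nr).
    assert (E2 := fl_rot_refl false a f1 _ _ H1 R A11 nr).
    apply nab. assert (E3 : s10 == 2 * b); [| lincomb (E3 - E1)%eqm].
    apply (fl_refl_refl false b f2); auto.
    apply (refl_eqm s11); auto using circ_fl. lincomb (E2 - E1)%eqm.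
Qed.

(** * Polar coordinates and the elements of O(2) *)

Definition polar (rho x : R) : R * R := (rho * cos x, rho * sin x).
Definition norm (z : R * R) : R := sqrt (fst z * fst z + snd z * snd z).
(** The origin gets a default angle; [polar_arg] holds there because the radius is 0. *)
Definition arg (z : R * R) : R :=
  if Rle_dec 0 (snd z) then acos (fst z / norm z) else - acos (fst z / norm z).

Lemma polar_eqm rho x y : x == y -> polar rho x = polar rho y.
Proof. intros [H1 H2]. unfold polar. congruence. Qed.

Lemma polar_inj rho x y : rho <> 0 -> polar rho x = polar rho y -> x == y.
Proof.
  unfold polar. intros n H. injection H as H1 H2.
  split; [apply (Rmult_eq_reg_l rho) | apply (Rmult_eq_reg_l rho)]; auto.
Qed.

Lemma norm_polar rho x : 0 <= rho -> norm (polar rho x) = rho.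
Proof.
  intros H. unfold norm, polar; simpl.
  assert (C := sin2_cos2 x). unfold Rsqr in C.
  replace (_ + _) with (rho * rho) by nra. apply sqrt_square; auto.
Qed.

Lemma norm_ge0 z : 0 <= norm z.
Proof. apply sqrt_pos. Qed.

Lemma norm_sqr z : norm z * norm z = fst z * fst z + snd z * snd z.
Proof. apply sqrt_sqrt. nra. Qed.

Lemma norm_eq0 z : norm z = 0 -> z = (0, 0).
Proof.
  intros H. assert (K := norm_sqr z). rewrite H in K. destruct z as [x y]; simpl in K.
  f_equal; nra.
Qed.

Lemma polar_arg z : polar (norm z) (arg z) = z.
Proof.
  destruct (Req_dec_T (norm z) 0) as [E | E].
  { rewrite E. apply norm_eq0 in E. subst. unfold polar. f_equal; ring. }
  assert (P : 0 < norm z) by (pose proof (norm_ge0 z); lra).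
  assert (K := norm_sqr z). unfold arg, polar. destruct z as [x y]; simpl in *.
  set (n := norm (x, y)) in *.
  set (t := x / n). assert (Ht : x = n * t) by (unfold t; field; auto).
  assert (B : -1 <= t <= 1).
  { assert (t * t <= 1); [| split; nra].
    apply (Rmult_le_reg_l (n * n)); [nra |]. rewrite Ht in K. nra. }
  assert (S : n * sqrt (1 - t²) = Rabs y).
  { rewrite <- (sqrt_square n) at 1 by lra. rewrite <- sqrt_mult; [| nra | unfold Rsqr; nra].
    rewrite <- sqrt_Rsqr_abs. f_equal. unfold Rsqr. rewrite Ht in K. nra. }
  destruct (Rle_dec 0 y) as [Hy | Hy]; [| rewrite cos_neg, sin_neg];
    rewrite cos_acos, sin_acos by auto; f_equal; auto.
  - rewrite S. apply Rabs_right; lra.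
  - rewrite Rabs_left in S by lra. lra.
Qed.

Lemma arg_polar rho x : 0 < rho -> arg (polar rho x) == x.
Proof.
  intros H. apply (polar_inj rho); [lra |].
  rewrite <- (polar_arg (polar rho x)) at 2. rewrite norm_polar; auto. lra.
Qed.

Lemma unit_angle a c : a * a + c * c = 1 -> exists s, cos s = a /\ sin s = c.
Proof.
  intros H. exists (arg (a, c)).
  assert (K := polar_arg (a, c)). unfold norm in K; simpl in K. rewrite H, sqrt_1 in K.
  unfold polar in K. injection K as K1 K2. split; lra.
Qed.

(** The determinant [k] is 1 or -1, and the second column is [k] times the first one turned by a
    right angle. *)
Lemma O2_angle g : O2 g ->
  exists s, (forall rho x, g (polar rho x) = polar rho (x + s)) \/
            (forall rho x, g (polar rho x) = polar rho (s - x)).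
Proof.
  intros [a [b [c [d [H1 [H2 [H3 H]]]]]]].
  destruct (unit_angle a c H1) as [s [Ca Cs]]. exists s.
  set (k := a * d - b * c).
  assert (Kb : b = - c * k).
  { transitivity (b * (a * a + c * c) - a * (a * b + c * d)); [rewrite H1, H3 | unfold k]; ring. }
  assert (Kd : d = a * k).
  { transitivity (d * (a * a + c * c) - c * (a * b + c * d)); [rewrite H1, H3 | unfold k]; ring. }
  assert (Kk : (k - 1) * (k + 1) = 0).
  { transitivity ((a * a + c * c) * (b * b + d * d) - (a * b + c * d) * (a * b + c * d) - 1);
      [unfold k | rewrite H1, H2, H3]; ring. }
  apply Rmult_integral in Kk as [Kk | Kk]; [left | right]; intros rho x;
    unfold polar; rewrite H, ?cos_plus, ?sin_plus, ?cos_minus, ?sin_minus, Ca, Cs, Kb, Kd.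
  - replace k with 1 by lra. f_equal; ring.
  - replace k with (-1) by lra. f_equal; ring.
Qed.

(** Reflection in the line through the origin at angle s / 2. *)
Definition mirror (s : R) (z : R * R) : R * R :=
  (cos s * fst z + sin s * snd z, sin s * fst z + - cos s * snd z).

Lemma O2_mirror s : O2 (mirror s).
Proof.
  exists (cos s), (sin s), (sin s), (- cos s).
  assert (C := sin2_cos2 s). unfold Rsqr in C.
  repeat split; simpl; try nra. Qed.

Lemma mirror_polar s rho x : mirror s (polar rho x) = polar rho (s - x).
Proof. unfold mirror, polar; simpl. rewrite cos_minus, sin_minus. f_equal; ring. Qed.

Lemma mirrorK s z : mirror s (mirror s z) = z.
Proof.
  rewrite <- (polar_arg z), !mirror_polar. f_equal; ring.
Qed.

Lemma mirror_neq_id s : ~ forall z, mirror s z = z.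
Proof.
  intros H. assert (H1 := H (1, 0)). assert (H2 := H (0, 1)).
  unfold mirror in *; simpl in *. injection H1 as H1 _. injection H2 as _ H2. lra.
Qed.

(** * The upper bound in the plane *)

Definition recolor (rho : R) (f : R -> bool) (c : R * R -> bool) : R * R -> bool :=
  fun z => if Req_dec_T (norm z) rho then f (arg z) else c z.

Lemma recolor_on rho f c x : 0 < rho -> circ f -> recolor rho f c (polar rho x) = f x.
Proof.
  intros H Hf. unfold recolor. rewrite norm_polar by lra.
  destruct (Req_dec_T rho rho); [| tauto]. apply Hf, arg_polar; auto.
Qed.

Lemma recolor_off rho f c z : norm z <> rho -> recolor rho f c z = c z.
Proof. intros H. unfold recolor. destruct (Req_dec_T (norm z) rho); tauto. Qed.

Lemma circ_polar (c : R * R -> bool) rho : circ (fun x => c (polar rho x)).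
Proof. intros x y E. rewrite (polar_eqm _ _ _ E); auto. Qed.

Lemma recolor_agrees (W : R * R -> Prop) rho f c c0 : 
  (forall z, ~ W z -> c z = c0 z) ->
  (forall x, ~ W (polar rho x) -> f x = c0 (polar rho x)) ->
  forall z, ~ W z -> recolor rho f c z = c0 z.
Proof.
  intros Hc Hf z nz. unfold recolor. destruct (Req_dec_T (norm z) rho) as [E | E]; auto.
  rewrite <- (polar_arg z), E in nz. rewrite Hf; auto.
  rewrite <- E, polar_arg; auto.
Qed.

Lemma fl_agrees (W : R * R -> Prop) rho i a (c0 : R * R -> bool) x : W (polar rho a) ->
  ~ W (polar rho x) -> fl i a (fun x => c0 (polar rho x)) x = c0 (polar rho x).
Proof.
  intros Wa nx. destruct i; simpl; auto. apply flip_off.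
  intros E; apply nx. rewrite (polar_eqm _ _ _ E); auto.
Qed.

Lemma distinguishing_of_circles c :
  (forall s, (forall rho x, c (polar rho (x + s)) = c (polar rho x)) -> s == 0) ->
  (forall s, ~ forall rho x, c (polar rho (s - x)) = c (polar rho x)) ->
  distinguishing O2 c.
Proof.
  intros H1 H2 g Og Hg z.
  destruct (O2_angle g Og) as [s [K | K]].
  - rewrite <- (polar_arg z), K. apply polar_eqm.
    assert (E : s == 0); [| lincomb E].
    apply H1. intros rho x. rewrite <- K; auto.
  - destruct (H2 s). intros rho x. rewrite <- K; auto.
Qed.

Lemma prop_P_two_circles (W : R * R -> Prop) r1 r2 a b : 0 < r1 -> 0 < r2 -> r1 <> r2 ->
  W (polar r1 a) -> W (polar r2 b) -> ~ 2 * a == 2 * b -> prop_P O2 W.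
Proof.
  intros P1 P2 n Wa Wb nab c0.
  set (f1 x := c0 (polar r1 x)). set (f2 x := c0 (polar r2 x)).
  assert (H1 : circ f1) by apply circ_polar. assert (H2 : circ f2) by apply circ_polar.
  destruct (two_circles f1 f2 a b H1 H2 nab) as [i [j N]].
  set (c := recolor r1 (fl i a f1) (recolor r2 (fl j b f2) c0)).
  assert (C1 : forall x, c (polar r1 x) = fl i a f1 x).
  { intros x. apply recolor_on; auto using circ_fl. }
  assert (C2 : forall x, c (polar r2 x) = fl j b f2 x).
  { intros x. unfold c. rewrite recolor_off by (rewrite norm_polar; lra).
    apply recolor_on; auto using circ_fl. }
  exists c; split.
  - apply recolor_agrees; [apply recolor_agrees; auto |]; intros x nx;
      apply (fl_agrees W); auto.
  - apply distinguishing_of_circles.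
    + intros s H. apply NNPP; intros ns. apply N; left; exists s; split; [| split]; auto;
        intros x; rewrite <- ?C1, <- ?C2; auto.
    + intros s H. apply N; right; exists s; split; intros x; rewrite <- ?C1, <- ?C2; auto.
Qed.

Lemma prop_P_one_circle (W : R * R -> Prop) rho : 0 < rho ->
  ge6 (fun x => W (polar rho x)) -> prop_P O2 W.
Proof.
  intros P H6 c0.
  assert (HW : closed (fun x => W (polar rho x))).
  { intros x y E. rewrite (polar_eqm _ _ _ E); auto. }
  assert (B := circle_extension _ _ (circ_polar c0 rho) HW H6).
  apply not_all_ex_not in B as [f B].
  apply imply_to_and in B as [Hf B]. apply imply_to_and in B as [A B].
  set (c := recolor rho f c0).
  assert (C : forall x, c (polar rho x) = f x) by (intros x; apply recolor_on; auto).
  exists c; split.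
  - apply recolor_agrees; auto.
  - apply distinguishing_of_circles.
    + intros s H. apply NNPP; intros ns. apply B; left; exists s; split; auto.
      intros x; rewrite <- !C; auto.
    + intros s H. apply B; right; exists s. intros x; rewrite <- !C; auto.
Qed.

(** Otherwise the nonzero points of [W] lie on one line through the origin, and the reflection in it
    fixes [W] pointwise. The doubled angle identifies the line. *)
Lemma independent_pair (W : R * R -> Prop) : trivial_pointwise_stab O2 W ->
  exists r1 r2 a b, 0 < r1 /\ 0 < r2 /\ W (polar r1 a) /\ W (polar r2 b) /\ ~ 2 * a == 2 * b.
Proof.
  intros T. apply NNPP; intros N.
  assert (M : exists s, forall z, W z -> norm z <> 0 -> 2 * arg z == s).
  { destruct (classic (exists z, W z /\ norm z <> 0)) as [[w [Ww nw]] | K].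
    - exists (2 * arg w). intros z Wz nz. apply NNPP; intros E. apply N.
      exists (norm z), (norm w), (arg z), (arg w). rewrite !polar_arg.
      pose proof (norm_ge0 z). pose proof (norm_ge0 w). repeat split; auto; lra.
    - exists 0. intros z Wz nz. destruct K; exists z; auto. }
  destruct M as [s Hs]. apply (mirror_neq_id s). apply T; [apply O2_mirror |].
  intros z Wz. destruct (Req_dec_T (norm z) 0) as [E | E].
  - apply norm_eq0 in E. subst. unfold mirror; simpl. f_equal; ring.
  - rewrite <- (polar_arg z), mirror_polar at 1. rewrite <- (polar_arg z) at 3.
    apply polar_eqm. assert (K := Hs z Wz E). lincomb (- K)%eqm.
Qed.

Lemma ext_bound_7 : ext_bound O2 7.
Proof.
  intros W [l [Ll [Nl Hl]]] T.
  destruct (independent_pair W T) as [r1 [r2 [a [b [P1 [P2 [Wa [Wb nab]]]]]]]].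
  destruct (Req_dec_T r1 r2) as [<- | n]; [| apply (prop_P_two_circles W r1 r2 a b); auto].
  (* A point off the circle of radius [r1] is independent of one of the two. *)
  destruct (classic (exists z, W z /\ norm z <> 0 /\ norm z <> r1)) as [[z [Wz [n0 n1]]] | K].
  - assert (Pz : 0 < norm z) by (pose proof (norm_ge0 z); lra).
    assert (Wz' : W (polar (norm z) (arg z))) by (rewrite polar_arg; auto).
    destruct (eqm_dec (2 * a) (2 * arg z)) as [E | E].
    + apply (prop_P_two_circles W r1 (norm z) b (arg z)); auto.
      intros E'; apply nab; lincomb (E - E')%eqm.
    + apply (prop_P_two_circles W r1 (norm z) a (arg z)); auto.
  - apply (prop_P_one_circle W r1); auto.
    intros L HL. apply NNPP; intros N.
    (* The origin and five classes on the circle give at most six points, but [l] has seven. *)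
    assert (I : incl l ((0, 0) :: map (polar r1) L)).
    { intros z Iz. destruct (Req_dec_T (norm z) 0) as [E | E].
      { left. symmetry; apply norm_eq0; auto. }
      right. assert (E' : norm z = r1).
      { apply NNPP; intros E'. apply K; exists z; auto. }
      apply NNPP; intros Nz. apply N. exists (arg z). rewrite <- E', polar_arg.
      split; auto. intros y Iy Ey. apply Nz.
      rewrite <- (polar_arg z), E', (polar_eqm _ _ _ Ey). apply in_map; auto. }
    apply NoDup_incl_length in I; auto. simpl in I. rewrite length_map in I. lia.
Qed.

(** * The lower bound: a regular pentagon with its center *)

Definition vertex (k : nat) : R * R := polar 1 (INR k * (2 * PI / 5)).

Definition centered_pentagon : list (R * R) := (0, 0) :: map vertex (seq 0 5).

Lemma neqm_0 x : 0 < x < 2 * PI -> ~ x == 0.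
Proof.
  intros H [E _]. rewrite cos_0 in E.
  replace x with (2 * (x / 2)) in E by field. rewrite cos_2a_sin in E.
  assert (S : 0 < sin (x / 2)) by (apply sin_gt_0; lra). nra.
Qed.

Lemma vertex_inj i j : (i < 5)%nat -> (j < 5)%nat -> vertex i = vertex j -> i = j.
Proof.
  assert (K : forall i j, (i < j < 5)%nat -> vertex i <> vertex j).
  { clear. intros i j H E. apply polar_inj in E; [| lra].
    apply (neqm_0 ((INR j - INR i) * (2 * PI / 5))); [| lincomb (- E)%eqm].
    assert (B : 1 <= INR j - INR i <= 4).
    { rewrite <- minus_INR by lia. change 1 with (INR 1).
      replace 4 with (INR 4) by (simpl; ring). split; apply le_INR; lia. }
    assert (P := PI_RGT_0). nra. }
  intros Hi Hj E. destruct (Nat.lt_trichotomy i j) as [L | [L | L]]; auto; exfalso.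
  - apply (K i j); auto.
  - apply (K j i); auto.
Qed.

Lemma pentagon_NoDup : NoDup centered_pentagon.
Proof.
  constructor.
  - rewrite in_map_iff. intros [k [E _]].
    assert (N := norm_polar 1 (INR k * (2 * PI / 5)) Rle_0_1).
    fold (vertex k) in N. rewrite E in N. unfold norm in N; simpl in N.
    replace (0 * 0 + 0 * 0) with 0 in N by ring. rewrite sqrt_0 in N. lra.
  - apply NoDup_map_NoDup_ForallPairs; [| apply seq_NoDup].
    intros i j Hi Hj. apply in_seq in Hi, Hj. apply vertex_inj; lia.
Qed.

(** The added 5 keeps the natural subtraction from truncating; it costs one full turn, which [h]
    removes. *)
Lemma mirror_vertex m k : (k < 5)%nat ->
  mirror (INR m * (2 * PI / 5)) (vertex k) = vertex ((m + 5 - k) mod 5).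
Proof.
  intros H. unfold vertex. rewrite mirror_polar. apply polar_eqm.
  assert (h := eqm_2PI).
  assert (P : forall n, INR n * (2 * PI) == 0).
  { induction n as [| n IH]; [simpl; rewrite Rmult_0_l; apply eqm_refl |].
    rewrite S_INR. lincomb (IH + h)%eqm. }
  set (q := ((m + 5 - k) / 5)%nat). set (r := ((m + 5 - k) mod 5)%nat).
  assert (D : (m + 5 = k + (5 * q + r))%nat).
  { unfold q, r. rewrite <- Nat.div_mod_eq. lia. }
  apply (f_equal INR) in D. rewrite !plus_INR, mult_INR in D.
  replace (INR 5) with 5 in D by (simpl; ring).
  assert (Q := P q).
  refine (eqm_of_diff _ _ _ _ (eqm_sub _ _ _ _ Q h) _). nra.
Qed.

Lemma mirror_pentagon m z : In z centered_pentagon -> In (mirror (INR m * (2 * PI / 5)) z) centered_pentagon.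
Proof.
  intros [<- | H].
  - left. unfold mirror; simpl. f_equal; ring.
  - right. apply in_map_iff in H as [k [<- Hk]]. apply in_seq in Hk.
    rewrite mirror_vertex by lia. apply in_map, in_seq.
    pose proof (Nat.mod_upper_bound (m + 5 - k) 5). lia.
Qed.

(** One color occurs at most twice, and some reflection of the pentagon preserves any set of at most
    two vertices. The proof tests all 32 colorings against the five axes. *)
Lemma pentagon_coloring_symmetric (b : nat -> bool) :
  exists m, forall k, (k < 5)%nat -> b ((m + 5 - k) mod 5)%nat = b k.
Proof.
  destruct (b 0%nat) eqn:E0, (b 1%nat) eqn:E1, (b 2%nat) eqn:E2,
    (b 3%nat) eqn:E3, (b 4%nat) eqn:E4;
  first [exists 0%nat; solve [intros [|[|[|[|[|k]]]]] H; simpl; try congruence; lia]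
       | exists 1%nat; solve [intros [|[|[|[|[|k]]]]] H; simpl; try congruence; lia]
       | exists 2%nat; solve [intros [|[|[|[|[|k]]]]] H; simpl; try congruence; lia]
       | exists 3%nat; solve [intros [|[|[|[|[|k]]]]] H; simpl; try congruence; lia]
       | exists 4%nat; solve [intros [|[|[|[|[|k]]]]] H; simpl; try congruence; lia]].
Qed.

Lemma pentagon_not_P : ~ prop_P O2 (fun z => In z centered_pentagon).
Proof.
  intros H. destruct (H (fun _ => false)) as [c [Hc D]].
  destruct (pentagon_coloring_symmetric (fun k => c (vertex k))) as [m Hm].
  apply (mirror_neq_id (INR m * (2 * PI / 5))), D; [apply O2_mirror |].
  intros z. destruct (classic (In z centered_pentagon)) as [[<- | I] | I].
  - f_equal. unfold mirror; simpl. f_equal; ring.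
  - apply in_map_iff in I as [k [<- Hk]]. apply in_seq in Hk.
    rewrite mirror_vertex, Hm by lia. auto.
  (* Being an involution that preserves the pentagon and its center, the reflection preserves their
     complement, where [c] is constant. *)
  - rewrite !Hc; auto. intros I'. apply I. rewrite <- (mirrorK (INR m * (2 * PI / 5)) z).
    apply mirror_pentagon; auto.
Qed.

Lemma pentagon_trivial_stab : trivial_pointwise_stab O2 (fun z => In z centered_pentagon).
Proof.
  intros g [a [b [c [d [_ [_ [_ H]]]]]]] F.
  assert (F0 : g (vertex 0) = vertex 0) by (apply F; simpl; auto).
  assert (F1 : g (vertex 1) = vertex 1) by (apply F; simpl; auto).
  unfold vertex, polar in F0, F1. simpl in F0, F1. rewrite H in F0, F1.
  rewrite !Rmult_0_l, cos_0, sin_0 in F0. rewrite !Rmult_1_l in F1.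
  injection F0 as A C. injection F1 as B D.
  assert (P := PI_RGT_0).
  (* This makes vertices 0 and 1 linearly independent. *)
  assert (S : 0 < sin (2 * PI / 5)) by (apply sin_gt_0; lra).
  replace a with 1 in * by lra. replace c with 0 in * by lra.
  assert (b = 0) by nra. assert (d = 1) by nra. subst b d.
  intros [x y]. rewrite H. f_equal; ring.
Qed.

Lemma card_ge_le {X : Type} (W : X -> Prop) m k : (k <= m)%nat -> card_ge W m -> card_ge W k.
Proof.
  intros L [l [Hl [N I]]]. exists (firstn k l). split; [| split].
  - rewrite length_firstn. lia.
  - rewrite <- (firstn_skipn k l) in N. apply NoDup_app_remove_r in N; auto.
  - intros x Hx. apply I. rewrite <- (firstn_skipn k l). apply in_or_app; auto.
Qed.

Theorem theorem3p1 : extD_eq O2 7.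
Proof.
  split; [exact ext_bound_7 |].
  intros k Hk. destruct (Nat.le_gt_cases 7 k) as [L | L]; auto.
  destruct pentagon_not_P. apply Hk.
  - apply (card_ge_le _ 6); [lia |].
    exists centered_pentagon; split; [reflexivity | split]; auto using pentagon_NoDup.
  - exact pentagon_trivial_stab.
Qed.
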